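(* There is an absolute constant $c>0$ such that the following holds. Let $r\ge2$ and $\delta>0$, and let $P_1,\dots,P_n\colon\mathbb{F}_2^m\to\mathbb{F}_2$ be polynomials of degree at most $3$ such that $\operatorname{rank}_2(P_i)\le r\le\sqrt{\log\log n}$ and $|\Pr_X[P_i(X)=1]-1/3|\ge\delta$ for all $i\in[n]$. Let $\mathcal{P}$ be the distribution of $(P_1(X),\dots,P_n(X))$ for $X$ uniform on $\mathbb{F}_2^m$. Then \[ \|\mathcal{P}-\mathrm{Ber}(1/3)^{\otimes n}\|_{\mathtt{TV}}\ \ge\ 1-\frac{2^{-(\log n)^{c/r^2}}}{\delta^2}. \]
   Context: Logarithms are base 2. For $P$ not identically zero, $\operatorname{rank}_2(P)$ is the smallest positive integer $k$ such that $P=\Gamma(Q_1,\dots,Q_k)$ for some polynomials $Q_j$ of degree at most $2$ and some $\Gamma\colon\mathbb{F}_2^k\to\mathbb{F}_2$. Total variation distance: $\frac12\sum_x|\mathcal{D}_1(x)-\mathcal{D}_2(x)|$. *)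

(* Defs.v *)
From mathcomp Require Import all_boot.
From Stdlib Require Import Reals.
Set Implicit Arguments. Unset Strict Implicit. Unset Printing Implicit Defensive.

(* Points of F_2^m, with F_2 represented by bool (addition = xor = addb,
   multiplication = andb). *)
Definition pt (m : nat) := {ffun 'I_m -> bool}.

(* A function f : F_2^m -> F_2 is a polynomial of degree at most d iff it is
   an F_2-linear combination (xor) of monomials prod_{i in S} x_i with |S| <= d.
   (Over F_2, x_i^2 = x_i, so multilinear monomials suffice.) *)
Definition poly_deg_le (m d : nat) (f : pt m -> bool) : Prop :=
  exists coef : {set 'I_m} -> bool,
    forall x : pt m,
      f x = \big[addb/false]_(S : {set 'I_m} | (#|S| <= d) && coef S)
              \big[andb/true]_(i in S) x i.

Definition rank2_le (m : nat) (P : pt m -> bool) (r : nat) : Prop :=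
  exists k : nat, is_true (leq 1 k) /\ is_true (leq k r) /\
    exists (Q : 'I_k -> pt m -> bool) (Gamma : {ffun 'I_k -> bool} -> bool),
      (forall j, poly_deg_le 2 (Q j)) /\
      (forall x : pt m, P x = Gamma [ffun j => Q j x]).

Open Scope R_scope.

Definition log2 (x : R) : R := ln x / ln 2.

Definition prob1 (m : nat) (f : pt m -> bool) : R :=
  INR #|[set x : pt m | f x]| / 2 ^ m.

Definition polydist (m n : nat) (P : 'I_n -> pt m -> bool)
  (y : {ffun 'I_n -> bool}) : R :=
  INR #|[set x : pt m | [ffun i => P i x] == y]| / 2 ^ m.

Definition ber13n (n : nat) (y : {ffun 'I_n -> bool}) : R :=
  \big[Rmult/1]_(i : 'I_n) (if y i then 1/3 else 2/3).

Definition tvdist (n : nat) (D1 D2 : {ffun 'I_n -> bool} -> R) : R :=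
  / 2 * \big[Rplus/0]_(y : {ffun 'I_n -> bool}) Rabs (D1 y - D2 y).

(* Main.v *)
(** Over a family of pairwise uncorrelated outputs, a weighted sum of the output
bits is concentrated, by Chebyshev's inequality, around different values under
the two laws, because the mean of a function of [K] independent unbiased bits is
dyadic and so at distance at least [2 ^- K / 3] from [1/3].  This still works
conditionally on the values of a few common functions [C], each output depending
on [C] and on a small set [U j] of private quadratics.

So call two outputs adjacent if some nonempty sums of their private functions,
together with a sum of common functions, add up to a biased function.  Either
there is a large independent set, and the test applies; or some output has many
neighbours.  In the latter case, by pigeonhole, many outputs share a quadratic
[q] such that [q + g j] is biased for a nonempty sum [g j] of private functions
of [j].  If [g j] is linear, Bessel's inequality leaves few possibilities for it,
so it becomes common for many [j] and one private function is dropped.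
Otherwise, a biased quadratic being a function of few linear forms, [q] becomes
common and a nonlinear private function is traded for few linear ones.  The
correlation threshold is chosen at each stage in terms of the current number of
functions, and at most [r] stages trade a nonlinear function, so
[log n >= 2 ^ O(r) (r + s) ^ 2] outputs suffice for distance [1 - 2 ^- s]. *)

Require Import Defs.
From Stdlib Require Import ZArith Reals Lra Psatz.
From mathcomp Require Import all_boot all_order all_algebra.
Set Implicit Arguments. Unset Strict Implicit. Unset Printing Implicit Defensive.
Open Scope R_scope.

(** * Choice of the parameters *)

Lemma INR_expn (a k : nat) : INR (a ^ k)%N = INR a ^ k.
Proof. by elim: k => [|k IH] //=; rewrite expnS mult_INR IH. Qed.

Lemma ln2_gt_half : 1 / 2 < ln 2.
Proof.
apply: exp_lt_inv; rewrite exp_ln; last by lra.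
have e3 := exp_le_3; have p := exp_pos (1 / 2).
have e2 : exp (1 / 2) * exp (1 / 2) = exp 1 by rewrite -exp_plus; congr exp; lra.
by nra.
Qed.

Lemma Rpower2_log2 x : 0 < x -> Rpower 2 (log2 x) = x.
Proof.
move=> x0; have l2 := ln2_gt_half; rewrite /Rpower /log2.
have -> : ln x / ln 2 * ln 2 = ln x by field; lra.
exact: exp_ln.
Qed.

Lemma log2_pos_gt1 x : 0 < log2 x -> 1 < x.
Proof.
have l2 := ln2_gt_half; rewrite /log2 => h; apply: Rnot_le_lt => x1.
have : ln x <= 0.
  have [x0|x0] := Rle_or_lt x 0.
    (* [ln] takes the default value 0 at nonpositive arguments. *)
    by rewrite /ln; case: (Rlt_dec 0 x) => [h'|_]; [exfalso; lra|right].
  have [->|ne] := Req_dec x 1; first by rewrite ln_1; right.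
  by left; rewrite -ln_1; apply: ln_increasing; lra.
move=> lx; have := Rmult_lt_0_compat _ _ h (Rlt_trans _ _ _ (ltac:(lra) : 0 < 1 / 2) l2).
by rewrite /Rdiv Rmult_assoc Rinv_l; lra.
Qed.

(** With [L] the iterated logarithm of [n], [s = 2 ^ (L / (10000 r^2))]. If [L <= 1000 r^2], this is
    at most [2 ^ (1/10) <= 11/10], where the final bound is vacuous; otherwise [L] dominates [9 r],
    and rounding [s] up to [k] still leaves enough outputs. *)
Lemma parameters (r n : nat) : is_true (leq 2 r) ->
  INR r <= sqrt (log2 (log2 (INR n))) ->
  let s := Rpower (log2 (INR n)) (/ 10000 / INR r ^ 2) in
  (0 < n)%N /\ (s <= 11 / 10 \/
    exists k : nat, s <= INR k /\ is_true (2 ^ (2 ^ (9 * r + 5) * (r + k + 2) ^ 2) <= n)%N).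
Proof.
move=> /leP/le_INR; rewrite [INR 2]/= => r2 rL s.
set L := log2 (log2 _) in rL.
have L0 : 0 < L.
  (* [sqrt] is 0 at nonpositive arguments, contradicting [2 <= r]. *)
  apply: Rnot_le_lt => L0; rewrite sqrt_neg_0 // in rL; lra.
have rrL : INR r ^ 2 <= L.
  rewrite -(sqrt_sqrt L); last by lra.
  by rewrite /= Rmult_1_r; apply: Rmult_le_compat; lra.
have N1 : 1 < log2 (INR n) by apply: log2_pos_gt1.
have n1 : 1 < INR n by apply: log2_pos_gt1; lra.
split; first by apply/ltP/INR_lt; rewrite /=; lra.
have l2 := ln2_gt_half.
have sE : s = Rpower 2 (/ 10000 / INR r ^ 2 * L).
  rewrite /s -{1}(@Rpower2_log2 (log2 (INR n))) ?Rpower_mult; last by lra.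
  by rewrite Rmult_comm.
have rr4 : 4 <= INR r ^ 2 by nra.
have [LK|LK] := Rle_or_lt L (1000 * INR r ^ 2).
  left; rewrite sE; apply: (Rle_trans _ (Rpower 2 (/ 10))).
    apply: Rle_Rpower; first by lra.
    have -> : / 10000 / INR r ^ 2 * L = / 10000 * (L / INR r ^ 2) by field; lra.
    have : L / INR r ^ 2 <= 1000.
      apply: (Rmult_le_reg_r (INR r ^ 2)); first by lra.
      by rewrite /Rdiv Rmult_assoc Rinv_l; lra.
    lra.
  have -> : 11 / 10 = Rpower (Rpower (11 / 10) 10) (/ 10).
    rewrite Rpower_mult Rinv_r; last by lra.
    by rewrite Rpower_1; lra.
  apply: Rle_Rpower_l; first by lra.
  split; first by lra.
  have e10 : INR 10 = 10 by rewrite /=; lra.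
  by rewrite -{2}e10 Rpower_pow; lra.
right; exists (Z.to_nat (up s)).
have s0 : 0 < s by apply: exp_pos.
have [u1 u2] := archimed s.
have kE : INR (Z.to_nat (up s)) = IZR (up s).
  rewrite INR_IZR_INZ Z2Nat.id //; apply: le_IZR; lra.
split; first by rewrite kE; lra.
set k := Z.to_nat _ in kE *.
(* Both [s] and [r + 3] are at most [A], so [r + k + 2 <= 2 A] and the total exponent is at most
   [9 r + 7 + L / 50 <= L]. *)
pose A := Rpower 2 (L / 100).
have sA : s <= A.
  rewrite sE; apply: Rle_Rpower; first by lra.
  have : / INR r ^ 2 <= / 4 by apply: Rinv_le_contravar; lra.
  by rewrite /Rdiv; nra.
have rA : INR r + 3 <= A.
  have := exp_ineq1_le (L / 100 * ln 2); rewrite -/(Rpower _ _) -/A.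
  by nra.
have NL : INR (2 ^ (9 * r + 5) * (r + k + 2) ^ 2) <= log2 (INR n).
  rewrite -(@Rpower2_log2 (log2 (INR n))) -/L; last by lra.
  rewrite mult_INR !INR_expn !plus_INR.
  have -> : INR 2 = 2 by [].
  rewrite -Rpower_pow; last by lra.
  apply: (Rle_trans _ (Rpower 2 (INR (9 * r + 5)) * Rpower 2 (2 + L / 50))).
    apply: Rmult_le_compat_l; first by apply: Rlt_le; apply: exp_pos.
    have -> : Rpower 2 (2 + L / 50) = (2 * A) ^ 2.
      have -> : 2 + L / 50 = INR 2 + (L / 100 + L / 100) by rewrite /=; lra.
      rewrite Rpower_plus (Rpower_plus (L / 100)) Rpower_pow -/A /=; lra.
    by apply: pow_incr; have := pos_INR r; have := pos_INR k; lra.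
  rewrite -Rpower_plus; apply: Rle_Rpower; first by lra.
  by rewrite plus_INR mult_INR /=; nra.
apply/leP/INR_le; rewrite INR_expn.
rewrite -(@Rpower2_log2 (INR n)); last by lra.
have -> : INR 2 = 2 by [].
rewrite -Rpower_pow; last by lra.
by apply: Rle_Rpower => //; lra.
Qed.

(** Here [delta ^ 2 <= 4/9], while [2 ^ (11/10) <= 9/4] because [2 ^ 11 <= (9/4) ^ 10]. *)
Lemma loss_trivial s delta : 0 < delta <= 2 / 3 -> s <= 11 / 10 ->
  1 - Rpower 2 (- s) / delta ^ 2 <= 0.
Proof.
move=> [d0 d23] s1; have d2 : 0 < delta ^ 2 by apply: pow_lt.
suff h : delta ^ 2 <= Rpower 2 (- s).
  have := Rmult_le_compat_r _ _ _ (Rlt_le _ _ (Rinv_0_lt_compat _ d2)) h.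
  by rewrite Rinv_r /Rdiv; lra.
apply: (Rle_trans _ (/ (9 / 4))); first by rewrite /=; nra.
rewrite Rpower_Ropp; apply: Rinv_le_contravar; first exact: exp_pos.
apply: (Rle_trans _ (Rpower 2 (11 / 10))); first by apply: Rle_Rpower; lra.
have e : 9 / 4 = Rpower (Rpower (9 / 4) 10) (/ 10).
  rewrite Rpower_mult Rinv_r; last by lra.
  by rewrite Rpower_1; lra.
have -> : Rpower 2 (11 / 10) = Rpower (Rpower 2 11) (/ 10).
  by rewrite Rpower_mult; congr Rpower; lra.
rewrite e; apply: Rle_Rpower_l; first by lra.
split; first exact: exp_pos.
have e10 : INR 10 = 10 by rewrite /=; lra.
have e11 : INR 11 = 11 by rewrite /=; lra.
by rewrite -e10 -e11 !Rpower_pow; lra.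
Qed.

Lemma loss_bound s delta k : 0 < delta <= 2 / 3 -> s <= INR k ->
  1 - Rpower 2 (- s) / delta ^ 2 <= 1 - / 2 ^ k.
Proof.
move=> [d0 d23] sk; have d2 : 0 < delta ^ 2 by apply: pow_lt.
have p0 : 0 < Rpower 2 (- s) by apply: exp_pos.
have h1 : / 2 ^ k <= Rpower 2 (- s).
  rewrite -Rpower_pow -?Rpower_Ropp; last by lra.
  by apply: Rle_Rpower; lra.
have h2 : 1 <= / delta ^ 2.
  rewrite -Rinv_1; apply: Rinv_le_contravar => //; rewrite /=; nra.
rewrite /Rdiv; nra.
Qed.

From mathcomp Require Import Rstruct ring lra zify.
Import Order.TTheory GRing.Theory Num.Theory.
Local Open Scope ring_scope.
Local Notation fn m := {ffun pt m -> bool}.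

(** * Biased quadratic functions *)

Ltac case_values f :=
  repeat match goal with |- context [fun_of_fin f ?x] => case: (fun_of_fin f x) end.

Section Analysis.
Variable R : realFieldType.

Definition mean (T : finType) (g : T -> R) : R := (\sum_x g x) / #|T|%:R.

Lemma mean_ge0 (T : finType) (g : T -> R) : (forall x, 0 <= g x) -> 0 <= mean g.
Proof. by move=> g0; rewrite divr_ge0 ?ler0n ?sumr_ge0. Qed.

Lemma meanZ (T : finType) a (g : T -> R) : mean (fun x => a * g x) = a * mean g.
Proof. by rewrite /mean -mulr_sumr mulrA. Qed.

Lemma meanD (T : finType) (g h : T -> R) :
  mean (fun x => g x + h x) = mean g + mean h.
Proof. by rewrite /mean big_split /= mulrDl. Qed.

Lemma mean_sum (T I : finType) (P : pred I) (g : I -> T -> R) :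
  mean (fun x => \sum_(i | P i) g i x) = \sum_(i | P i) mean (g i).
Proof. by rewrite /mean exchange_big /= mulr_suml. Qed.

Lemma eq_mean (T : finType) (g h : T -> R) : g =1 h -> mean g = mean h.
Proof. by move=> gh; rewrite /mean (eq_bigr h). Qed.

Lemma ler_mean (T : finType) (g h : T -> R) :
  (forall x, g x <= h x) -> mean g <= mean h.
Proof. by move=> gh; rewrite ler_wpM2r ?invr_ge0 ?ler0n // ler_sum. Qed.

Lemma mean_const (T : finType) (x0 : T) c : mean (fun _ : T => c) = c.
Proof.
rewrite /mean sumr_const -(mulr_natr c) mulfK // pnatr_eq0.
by apply/eqP; exact: fintype0.
Qed.

Lemma card_pt m : #|pt m| = (2 ^ m)%N.
Proof. by rewrite card_ffun card_bool card_ord. Qed.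

Lemma addbb0 (b : bool) : b + b = 0.
Proof. by case: b. Qed.

Lemma ptxx m (x : pt m) : x + x = 0.
Proof. by apply/ffunP=> i; rewrite !ffunE addbb0. Qed.

Lemma ptK m (z : pt m) : involutive (fun x => x + z).
Proof. by move=> x; rewrite -addrA ptxx addr0. Qed.

Definition bias m (f : fn m) : R := mean (fun x => (-1) ^+ f x).

Definition lin m : {set fn m} :=
  [set f : fn m | [forall x : pt m, forall y : pt m, f (x + y) == f x + f y]].

(** The third discrete derivative vanishes: degree at most 2, expressed without monomials. *)
Definition quadratic m (f : fn m) := forall x u v w : pt m,
  f x + f (x + u) + f (x + v) + f (x + w) + f (x + u + v) + f (x + u + w)
  + f (x + v + w) + f (x + u + v + w) = 0.

Definition determined_by m (A : {set fn m}) (g : pt m -> bool) :=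
  forall x y, (forall f, f \in A -> f x = f y) -> g x = g y.

Lemma linP m (f : fn m) : reflect {morph f : x y / x + y} (f \in lin m).
Proof.
rewrite inE; apply: (iffP forallP) => [h x y|h x].
  by have /forallP/(_ y)/eqP := h x.
by apply/forallP => y; rewrite h.
Qed.

Lemma lin_sum m (S : {set fn m}) : S \subset lin m -> \sum_(f in S) f \in lin m.
Proof.
move=> /subsetP Sl; apply/linP => x y; rewrite !sum_ffunE -big_split.
by apply: eq_bigr => f /Sl/linP ->.
Qed.

Lemma lin_quadratic m (f : fn m) : f \in lin m -> quadratic f.
Proof.
by move=> /linP fD x u v w; rewrite !fD; case_values f.
Qed.

Lemma quadraticD m (f g : fn m) : quadratic f -> quadratic g -> quadratic (f + g).
Proof.
move=> hf hg x u v w.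
pose l := [:: x; x + u; x + v; x + w; x + u + v; x + u + w; x + v + w; x + u + v + w].
have E (h : fn m) : h x + h (x + u) + h (x + v) + h (x + w) + h (x + u + v)
    + h (x + u + w) + h (x + v + w) + h (x + u + v + w) = \sum_(p <- l) h p.
  by rewrite !big_cons big_nil addr0 !addrA.
rewrite E; under eq_bigr do rewrite ffunE.
by rewrite big_split -!E hf hg.
Qed.

Lemma quadratic_sum m (S : {set fn m}) :
  (forall f, f \in S -> quadratic f) -> quadratic (\sum_(f in S) f).
Proof.
move=> hS; elim/big_ind: _ => [x u v w|f g|f /hS //]; last exact: quadraticD.
by rewrite !ffunE.
Qed.

(** Translation by [z] pairs points of opposite sign. *)
Lemma sum_sign_shift0 m (f : pt m -> bool) z :
  (forall x, f (x + z) = ~~ f x) -> \sum_x (-1) ^+ f x = 0 :> R.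
Proof.
move=> fz; set S := \sum_x _.
suff : S = - S by move=> h; lra.
rewrite {1}/S (reindex_inj (inv_inj (ptK z))) /= -sumrN.
by apply: eq_bigr => x _; rewrite fz; case: (f x); rewrite /= ?expr0 ?expr1 ?opprK.
Qed.

Lemma bias_lin m (f : fn m) : f \in lin m -> bias f = (f == 0)%:R.
Proof.
move=> fl; rewrite /bias; case: eqP => [->|/eqP f0].
  rewrite (@eq_mean _ _ (fun=> 1)) ?(mean_const (0 : pt m)) // => x.
  by rewrite ffunE expr0.
have [z fz] : exists z, f z.
  apply/existsP; apply: contraR f0 => /existsPn h; apply/eqP/ffunP => x.
  by rewrite ffunE; apply/negbTE.
rewrite /mean (@sum_sign_shift0 _ _ z) ?mul0r // => x.
by rewrite (linP _ fl) fz; case: (f x).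
Qed.

(** Signs of distinct linear forms are orthonormal, and [bias (q + l)] is the Fourier coefficient of
    the sign of [q] at [l]; the residual of the projection has nonnegative mean square. *)
Lemma bessel m (q : fn m) (L : {set fn m}) :
  L \subset lin m -> \sum_(l in L) bias (q + l) ^+ 2 <= 1.
Proof.
move=> /subsetP Ll; set s := fun (f : fn m) x => (-1) ^+ f x : R.
have sD f g x : s (f + g) x = s f x * s g x.
  by rewrite /s !ffunE; exact: signr_addb.
have : 0 <= mean (fun x => (s q x - \sum_(l in L) bias (q + l) * s l x) ^+ 2).
  by apply: mean_ge0 => x; exact: sqr_ge0.
set B := \sum_(l in L) _ ^+ 2.
have -> : mean (fun x => (s q x - \sum_(l in L) bias (q + l) * s l x) ^+ 2)
   = 1 - 2 * B + B; last by lra.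
rewrite (@eq_mean _ _ (fun x => (1 + (-2) * \sum_(l in L) bias (q + l) * s (q + l) x)
   + \sum_(l in L) \sum_(l' in L) bias (q + l) * bias (q + l') * s (l + l') x)).
  rewrite !meanD meanZ (mean_const (0 : pt m)) !mean_sum.
  rewrite mulNr; congr (1 - 2 * _ + _).
    by apply: eq_bigr => l _; rewrite meanZ -expr2.
  apply: eq_bigr => l lL; rewrite mean_sum (bigD1 l) //= big1 => [|l' /andP [l'L ne]].
    rewrite addr0 meanZ.
    have -> : mean (s (l + l)) = 1; last by rewrite mulr1 expr2.
    rewrite (@eq_mean _ _ (fun=> 1)) ?(mean_const (0 : pt m)) // => x.
    by rewrite sD -expr2 /s sqrr_sign.
  rewrite meanZ [mean _](@bias_lin _ (l + l')).
    have -> : (l + l' == 0) = false; last by rewrite mulr0.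
    apply: contraNF ne => /eqP h; apply/eqP/ffunP => x.
    by move/ffunP/(_ x): h; rewrite !ffunE; case: (l x) (l' x) => [] [].
  apply/linP => x y; rewrite !ffunE (linP _ (Ll _ lL)) (linP _ (Ll _ l'L)).
  exact: addrACA.
move=> x; rewrite sqrrB; congr (_ + _ + _).
- by rewrite /s sqrr_sign.
- rewrite mulNr -mulr_natl; congr (- (2 * _)).
  rewrite mulr_sumr; apply: eq_bigr => l _.
  by rewrite sD mulrCA.
- rewrite expr2 mulr_suml; apply: eq_bigr => l _; rewrite mulr_sumr.
  by apply: eq_bigr => l' _; rewrite sD mulrACA.
Qed.

(** Each such [l] contributes at least [2 ^- (2 * h)] to the sum in [bessel]. *)
Lemma card_biased_lin m (q : fn m) h :
  (#|[set l in lin m | (2%:R ^- h < `|bias (q + l)|)%R]| <= 2 ^ (2 * h))%N.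
Proof.
set L := [set l in _ | _].
have Ll : L \subset lin m by apply/subsetP=> l; rewrite inE => /andP[].
have := bessel q Ll.
have : \sum_(l in L) (2%:R ^- (2 * h) : R) <= \sum_(l in L) bias (q + l) ^+ 2.
  apply: ler_sum => l; rewrite inE => /andP[_ lt].
  rewrite mulnC exprM -exprVn -(real_normK (num_real (bias _))).
  by rewrite lerXn2r ?nnegrE ?invr_ge0 ?exprn_ge0 ?ler0n // ltW.
rewrite sumr_const => h1 h2; have := le_trans h1 h2.
rewrite -(mulr_natl (_^-1)) ler_pdivrMr ?exprn_gt0 ?ltr0n // mul1r.
by rewrite -natrX ler_nat.
Qed.

(** * Common zeros of linear forms *)

Definition zeros m (A : {set fn m}) : {set pt m} := [set z | [forall f in A, ~~ f z]].

Lemma zerosP m (A : {set fn m}) z :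
  reflect (forall f, f \in A -> f z = false) (z \in zeros A).
Proof.
rewrite inE; apply: (iffP forallP) => h f; first by move=> fA; apply/negbTE/(implyP (h f)).
by apply/implyP=> /h ->.
Qed.

Lemma zerosU1 m (f : fn m) A : zeros (f |: A) = zeros A :&: [set z | ~~ f z].
Proof.
apply/setP=> z; apply/zerosP/setIP => [h|[/zerosP h]].
  split; last by rewrite inE h // setU11.
  by apply/zerosP => g gA; apply: h; rewrite setU1r.
by rewrite inE => fz g /setU1P [->|/h //]; apply/negbTE.
Qed.

(** A form is kept only if it is not identically zero on the common zeros found so far; each kept
    form halves that set. *)
Lemma independent_forms m (l : seq (fn m)) : {subset l <= lin m} ->
  exists A : {set fn m}, [/\ A \subset lin m, zeros A = zeros [set f in l]
    & #|zeros A| * 2 ^ #|A| = #|pt m|]%N.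
Proof.
elim: l => [|f l IH] ll.
  exists set0; split; first exact: sub0set.
    by congr zeros; apply/setP=> f; rewrite !inE.
  rewrite cards0 muln1; apply: eq_card => z; rewrite [RHS]inE.
  by apply/zerosP => f; rewrite inE.
have [|A [Al Al' cA]] := IH; first by move=> g gl; apply: ll; rewrite inE gl orbT.
have fl : f \in lin m by apply: ll; rewrite mem_head.
have -> : [set g in f :: l] = f |: [set g in l].
  by apply/setP => g; rewrite !inE.
rewrite zerosU1 -Al'.
have [h|] := boolP [exists z in zeros A, f z]; last first.
  move=> /existsPn h; exists A; split=> //; apply/setP => z; rewrite [RHS]inE.
  case zA : (z \in zeros A) => //; rewrite inE.
  by have := h z; rewrite zA /= => ->.
case/existsP: h => z0 /andP[z0A fz0].
have fA : f \notin A by apply/negP => fA; move/zerosP/(_ _ fA): z0A; rewrite fz0.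
exists (f |: A); split; [by rewrite subUset sub1set fl|by rewrite zerosU1|].
rewrite cardsU1 fA /= add1n expnS mulnA -cA; congr muln.
rewrite zerosU1 muln2 -addnn -[RHS](cardsID [set z | ~~ f z]); congr addn.
(* Translation by [z0] exchanges the zeros of [f] with the remaining points of [zeros A]. *)
rewrite -(card_imset _ (inv_inj (ptK z0))); apply: eq_card => z.
apply/imsetP/setDP => [[y /setIP[yA]]|[zA]].
  rewrite !inE => fy -> /=.
  rewrite (linP _ fl) fz0 negbK; split; last by case: (f y) fy.
  apply/forallP => g; apply/implyP => gA.
  by rewrite (linP _ (subsetP Al _ gA)) (zerosP _ _ z0A _ gA) (zerosP _ _ yA _ gA).
rewrite inE negbK => fz; exists (z + z0); last by rewrite ptK.
apply/setIP; split; last by rewrite inE (linP _ fl) fz fz0.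
apply/zerosP => g gA.
by rewrite (linP _ (subsetP Al _ gA)) (zerosP _ _ z0A _ gA) (zerosP _ _ zA _ gA).
Qed.

(* A biased quadratic is invariant under the radical [H] of its polar form:
   its squared bias is the density of [H], so [H] is cut out by few linear
   forms. *)
Lemma biased_quadratic m (f : fn m) : quadratic f -> bias f != 0 ->
  exists A : {set fn m}, [/\ A \subset lin m, determined_by A f
    & bias f ^+ 2 * 2%:R ^+ #|A| = 1].
Proof.
move=> qf bf.
pose B u : fn m := [ffun y => f 0 + f u + f y + f (u + y)].
have BE x u y : f x + f (x + u) + f (x + y) + f (x + u + y) = B u y.
  rewrite ffunE; have := qf 0 x u y; rewrite !add0r.
  by case_values f.
have Bl u : B u \in lin m.
  apply/linP => y z; rewrite -(BE y u z) -(BE 0 u y) !add0r [B u _]ffunE.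
  by rewrite [u + (y + z)]addrA [y + u]addrC; case_values f.
  have [|A [Al Az cA]] := @independent_forms m [seq B u | u <- enum (pt m)].
  by move=> g /mapP[u _ ->].
pose H := zeros A.
have HP y : reflect (forall u, B u y = false) (y \in H).
  rewrite /H Az; apply: (iffP (zerosP _ _)) => h => [u|g].
    by apply: h; rewrite inE map_f // mem_enum.
  by rewrite inE => /mapP[u _ ->].
pose N : R := #|pt m|%:R.
pose S : R := \sum_x (-1) ^+ f x.
(* In the double sum of signs of [f x + f (x + y)], for fixed [y] the exponent is affine in [x] with
   linear part given by the polar form, so only [y] in the radical survive. *)
have SE : S ^+ 2 = N * \sum_(y in H) (-1) ^+ (f y (+) f 0).
  rewrite expr2 {1}/S mulr_suml.
  transitivity (\sum_x \sum_y ((-1) ^+ (f x (+) f (x + y)) : R)).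
    apply: eq_bigr => x _; rewrite /S mulr_sumr (reindex_inj (addrI x)) /=.
    by apply: eq_bigr => y _; rewrite signr_addb.
  rewrite exchange_big mulr_sumr (bigID (mem H)) /= [X in _ + X]big1 => [|y yH].
    rewrite addr0; apply: eq_bigr => y yH.
    transitivity (\sum_(x : pt m) ((-1) ^+ (f y (+) f 0) : R)); last first.
      by rewrite sumr_const mulr_natl.
    apply: eq_bigr => x _; congr (_ ^+ nat_of_bool _).
    by have := HP _ yH x; rewrite ffunE; case_values f.
  have [u Bu] : exists u, B u y.
    by apply/existsP; apply: contraR yH => /existsPn h; apply/HP => u; apply/negbTE.
  apply: (@sum_sign_shift0 m (fun x => f x (+) f (x + y)) u) => x.
  by have := BE x u y; rewrite Bu; case_values f.
have bS : bias f = S / N by [].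
have S0 : S != 0 by apply: contraNneq bf => S0; rewrite bS S0 mul0r.
(* Otherwise translation by [y] inside [H] flips every sign, forcing [S = 0]. *)
have fH y : y \in H -> f y = f 0.
  move=> yH; apply/eqP; apply: contraNT S0 => ne; rewrite -sqrf_eq0 SE.
  suff -> : \sum_(y in H) ((-1) ^+ (f y (+) f 0) : R) = 0 by rewrite mulr0.
  set T := \sum_(y in H) _; suff : T = - T by move=> h; lra.
  rewrite {1}/T (reindex_inj (inv_inj (ptK y))) /= -sumrN.
  have HD z : (z + y \in H) = (z \in H).
    apply/HP/HP => h u; have := h u; rewrite (linP _ (Bl u)) (HP _ yH);
    by case: (B u z).
  apply: eq_big => z; first exact: HD.
  rewrite HD => zH.
  have := HP _ yH z; rewrite ffunE => Bz.
  rewrite (_ : f (z + y) (+) f 0 = ~~ (f z (+) f 0)); first by rewrite signrN.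
  by move: Bz ne; case_values f.
exists A; split=> // [x y h|].
  have xyH : x + y \in H.
    apply/zerosP => g gA; rewrite (linP _ (subsetP Al _ gA)) h //; exact: addbb0.
  have := HP _ xyH x; rewrite ffunE addrA ptxx add0r.
  by rewrite (fH _ xyH); case_values f.
have SH : S ^+ 2 = N * #|H|%:R.
  rewrite SE (eq_bigr (fun=> 1)) ?sumr_const // => y yH.
  by rewrite fH // addbb.
rewrite bS expr_div_n SH.
have -> : N = #|H|%:R * 2 ^+ #|A| by rewrite -natrX -natrM cA.
have cH : (#|H|%:R : R) != 0.
  by apply: contraNneq S0 => H0; rewrite -sqrf_eq0 SH H0 mulr0.
have c2 : (2 : R) ^+ #|A| != 0 by rewrite expf_neq0 // pnatr_eq0.
move: (2 ^+ #|A|) (#|H|%:R) c2 cH => a b a0 b0.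
by field; rewrite ?a0 ?b0.
Qed.

Lemma biased_quadratic_forms m (f : fn m) h : quadratic f -> 2%:R ^- h < `|bias f| ->
  exists A : {set fn m}, [/\ A \subset lin m, determined_by A f & (#|A| <= 2 * h)%N].
Proof.
move=> qf hf; have h0 : 0 < (2%:R : R) ^- h by rewrite invr_gt0 exprn_gt0 ?ltr0n.
have [|A [Al Ad Ab]] := biased_quadratic qf.
  by rewrite -normr_gt0; exact: lt_trans hf.
exists A; split=> //.
have lt1 : 2%:R ^- (2 * h) < bias f ^+ 2.
  rewrite mulnC exprM -exprVn -(real_normK (num_real (bias _))).
  by rewrite ltrXn2r ?nnegrE ?invr_ge0 ?exprn_ge0 ?ler0n.
have : 2%:R ^- (2 * h) * 2%:R ^+ #|A| < (1 : R).
  by rewrite -[ltRHS]Ab ltr_pM2r // exprn_gt0 ?ltr0n.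
rewrite mulrC ltr_pdivrMr ?exprn_gt0 ?ltr0n // mul1r -!natrX ltr_nat ltn_exp2l //.
exact: ltnW.
Qed.

(** * The test for uncorrelated outputs *)

Lemma prodr_addr1 (T : finType) (V : {set T}) (a : T -> R) :
  \prod_(f in V) (1 + a f) = \sum_(S in powerset V) \prod_(f in S) a f.
Proof.
transitivity (\prod_f ((if f \in V then a f else 0) + 1)).
  rewrite big_mkcond; apply: eq_bigr => f _.
  by case: ifP => _; rewrite ?add0r // addrC.
rewrite bigA_distr [LHS](bigID (mem (powerset V))) /= [X in _ + X]big1 ?addr0.
  apply: eq_bigr => S; rewrite powersetE => /subsetP SV.
  rewrite [RHS]big_mkcond; apply: eq_bigr => f _.
  by case: ifP => // /SV ->.
move=> S; rewrite powersetE => /subsetPn[f fS fV].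
by rewrite (bigD1 f) //= fS (negbTE fV) mul0r.
Qed.

(** * Fourier expansion in the private functions *)

Definition trace m (V : {set fn m}) (x : pt m) : {set fn m} := [set f in V | f x].

Definition xsum m (S : {set fn m}) : fn m := \sum_(f in S) f.

Lemma sign_sum m (S : {set fn m}) x :
  (-1) ^+ xsum S x = \prod_(f in S) (-1) ^+ f x :> R.
Proof.
rewrite /xsum sum_ffunE; apply: (big_morph (fun b : bool => (-1) ^+ b)) => //.
exact: signr_addb.
Qed.

(** Fourier coefficients on the cube of formal values of [V], not averages over points; this makes
    the empty coefficient of a Boolean [G] dyadic. *)
Definition fhat m (V : {set fn m}) (G : {set fn m} -> R) (S : {set fn m}) : R :=
  (\sum_(u in powerset V) G u * \prod_(f in S) (-1) ^+ (f \in u)) / 2 ^+ #|V|.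

(** The product of the [1 + (-1) ^+ (f \in u) * (-1) ^+ f x] over [V] is [2 ^ #|V|] at
    [u = trace V x] and 0 at every other subset of [V]; expanding it gives the characters. *)
Lemma fourier m (V : {set fn m}) G x :
  G (trace V x) = \sum_(S in powerset V) fhat V G S * (-1) ^+ xsum S x.
Proof.
have p2 : (2 : R) ^+ #|V| != 0 by rewrite expf_neq0 // pnatr_eq0.
transitivity ((\sum_(u in powerset V) G u * \prod_(f in V)
    (1 + (-1) ^+ (f \in u) * (-1) ^+ f x)) / 2 ^+ #|V|).
  have tV : trace V x \in powerset V.
    by rewrite powersetE; apply/subsetP => f; rewrite inE => /andP[].
  rewrite (bigD1 (trace V x)) //= [X in _ + X]big1 ?addr0 => [|u /andP[uV ne]].
    rewrite (eq_bigr (fun=> 2)) ?prodr_const ?mulfK // => f fV.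
    by rewrite inE fV /= -expr2 sqrr_sign.
  have /existsP [f] : [exists f in V, (f \in u) != f x].
    apply: contraR ne; rewrite negb_exists => /forallP h; apply/eqP/setP => f.
    rewrite inE; have := h f; case fV: (f \in V) => /=; first by rewrite negbK => /eqP.
    move=> _; apply/negbTE; move: uV; rewrite powersetE => /subsetP/(_ f).
    by rewrite fV; case: (f \in u) => // /(_ isT).
  case/andP => fV hf; rewrite (bigD1 f) //=.
  suff -> : 1 + (-1) ^+ (f \in u) * (-1) ^+ f x = 0 :> R by rewrite mul0r mulr0.
  by rewrite -signr_addb; move: hf; case: (f \in u) (f x) => [] []; rewrite //= expr1 subrr.
under [RHS]eq_bigr do rewrite mulrAC mulr_suml.
rewrite -mulr_suml exchange_big; congr (_ / _); apply: eq_bigr => u _.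
rewrite prodr_addr1 mulr_sumr; apply: eq_bigr => S _.
by rewrite big_split /= sign_sum mulrA.
Qed.

Lemma fhat_le1 m (V : {set fn m}) G S : (forall u, `|G u| <= 1) -> `|fhat V G S| <= 1.
Proof.
move=> G1; have p2 : 0 < (2 : R) ^+ #|V| by rewrite exprn_gt0 // ltr0n.
rewrite /fhat normrM [X in _ * X]gtr0_norm ?invr_gt0 // ler_pdivrMr // mul1r.
apply: le_trans (ler_norm_sum _ _ _) _.
apply: le_trans (_ : \sum_(u in powerset V) (1 : R) <= _).
  apply: ler_sum => u _; rewrite normrM normr_prod big1 ?mulr1 // => f _.
  by rewrite normr_sign.
by rewrite sumr_const card_powerset natrX.
Qed.

Lemma fhat0 m (V : {set fn m}) G :
  fhat V G set0 = (\sum_(u in powerset V) G u) / 2 ^+ #|V|.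
Proof.
by congr (_ / _); apply: eq_bigr => u _; rewrite big_set0 mulr1.
Qed.

Lemma fourier_centered m (V : {set fn m}) G x :
  G (trace V x) - fhat V G set0 =
  \sum_(S in powerset V | S != set0) fhat V G S * (-1) ^+ xsum S x.
Proof.
rewrite (fourier _ G) (bigD1 set0) ?powersetE ?sub0set //= /xsum big_set0 ffunE expr0 mulr1.
by rewrite addrAC subrr add0r.
Qed.

(** Centering removes the empty terms. At most [2 ^ (#|C| + #|V| + #|V'|)] triples of characters
    remain, each with coefficient at most 1 and mean at most [eps]. *)
Lemma centered_corr m (C V V' : {set fn m}) (G0 G G' : {set fn m} -> R) eps :
  (forall u, `|G0 u| <= 1) -> (forall u, `|G u| <= 1) -> (forall u, `|G' u| <= 1) ->
  0 <= eps ->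
  (forall W S S' : {set fn m}, W \subset C -> S \subset V -> S' \subset V' ->
     S != set0 -> S' != set0 ->
     `|bias (xsum S + xsum S' + xsum W)| <= eps) ->
  `|mean (fun x => G0 (trace C x) * ((G (trace V x) - fhat V G set0)
      * (G' (trace V' x) - fhat V' G' set0)))| <= 2 ^+ (#|C| + #|V| + #|V'|) * eps.
Proof.
move=> h0 h h' e0 hb.
pose sg (S : {set fn m}) x : R := (-1) ^+ xsum S x.
rewrite (@eq_mean _ _ (fun x => \sum_(W in powerset C)
   \sum_(S in powerset V | S != set0) \sum_(S' in powerset V' | S' != set0)
     (fhat C G0 W * (fhat V G S * fhat V' G' S')) * (sg S x * sg S' x * sg W x))).
  rewrite mean_sum; apply: le_trans (ler_norm_sum _ _ _) _.
  rewrite !exprD -!natrX -!card_powerset -mulrA -!mulrA mulr_natl -sumr_const.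
  apply: ler_sum => W; rewrite powersetE => WC.
  rewrite mean_sum; apply: le_trans (ler_norm_sum _ _ _) _.
  rewrite mulr_natl -sumr_const big_mkcondr; apply: ler_sum => S.
  rewrite powersetE => SV; case: ifP => S0; last first.
    by rewrite mulr_ge0 ?ler0n.
  rewrite mean_sum; apply: le_trans (ler_norm_sum _ _ _) _.
  rewrite mulr_natl -sumr_const big_mkcondr; apply: ler_sum => S'.
  rewrite powersetE => SV'; case: ifP => S0' //.
  rewrite meanZ normrM.
  have -> : mean (fun x => sg S x * sg S' x * sg W x)
     = bias (xsum S + xsum S' + xsum W).
    by apply: eq_mean => x; rewrite /sg -!signr_addb !ffunE.
  rewrite -[leRHS]mul1r ler_pM ?normr_ge0 //; last exact: hb.
  have := @fhat_le1 _ C _ W h0; have := @fhat_le1 _ V _ S h; have := @fhat_le1 _ V' _ S' h'.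
  by move=> b3 b2 b1; rewrite normrM [X in _ * X]normrM !mulr_ile1 ?mulr_ge0.
move=> x; rewrite (fourier _ G0) !fourier_centered mulr_suml; apply: eq_bigr => W _.
rewrite mulr_suml mulr_sumr; apply: eq_bigr => S _.
rewrite mulr_sumr mulr_sumr; apply: eq_bigr => S' _.
rewrite -/(sg W x) -/(sg S x) -/(sg S' x).
move: (fhat C G0 W) (fhat V G S) (fhat V' G' S') (sg W x) (sg S x) (sg S' x) => *; ring.
Qed.

(** The integer [3 p - 2 ^ k] is nonzero, since 3 does not divide a power of 2. *)
Lemma dyadic_third (p k K : nat) : (k <= K)%N ->
  (9 * 4 ^+ K)^-1 <= (p%:R / 2 ^+ k - 3^-1 : R) ^+ 2.
Proof.
move=> kK; have p2 : 0 < (2 : R) ^+ k by rewrite exprn_gt0 // ltr0n.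
have ->: (p%:R / 2 ^+ k - 3^-1) ^+ 2 = (3 * p%:R - 2 ^+ k) ^+ 2 / (9 * 4 ^+ k) :> R.
  have -> : (4 : R) = 2 ^+ 2 by ring.
  by rewrite exprAC; move: (2 ^+ k) p2 => a a0; field; rewrite (gt_eqF a0).
have g1 : 1 <= (3 * p%:R - 2 ^+ k : R) ^+ 2.
  have : (2 ^ k < 3 * p)%N \/ (3 * p < 2 ^ k)%N.
    apply/orP; rewrite -neq_ltn; apply/eqP => e.
    have : (3 %| 2 ^ k)%N by rewrite e dvdn_mulr.
    by rewrite Euclid_dvdX.
  case; rewrite -(ler_nat R) -addn1 natrD natrM natrX.
    by move: (2 ^+ k) (p%:R) => a b h; nra.
  by move: (2 ^+ k) (p%:R) => a b h; nra.
have p4 j : 0 < 9 * (4 : R) ^+ j by rewrite mulr_gt0 ?exprn_gt0 ?ltr0n.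
apply: (@le_trans _ _ (9 * 4 ^+ k)^-1).
  by rewrite lef_pV2 ?posrE // ler_pM2l ?ltr0n // ler_weXn2l // ler1n.
by rewrite -[leLHS]mul1r ler_pM2r ?invr_gt0.
Qed.

(** * Second moments under the Bernoulli law *)

Definition ber n (y : {ffun 'I_n -> bool}) : R :=
  \prod_i (if y i then 3^-1 else 1 - 3^-1).

Lemma ber_ge0 n (y : {ffun 'I_n -> bool}) : 0 <= ber y.
Proof. by apply: prodr_ge0 => i _; case: (y i); lra. Qed.

Lemma ber_moment n (i j : 'I_n) :
  \sum_y ber y * (((y i)%:R - 3^-1) * ((y j)%:R - 3^-1)) = (i == j)%:R * (2 / 9).
Proof.
(* The Boolean exponents let the integrand factor over coordinates; a centered bit has mean 0 and
   variance 2/9. *)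
pose g (k : 'I_n) (b : bool) : R := (if b then 3^-1 else 1 - 3^-1)
   * (b%:R - 3^-1) ^+ (k == i) * (b%:R - 3^-1) ^+ (k == j).
transitivity (\sum_(y : {ffun 'I_n -> bool}) \prod_k g k (y k)).
  apply: eq_bigr => y _; rewrite !big_split /= mulrA; congr (_ * _ * _).
    rewrite (bigD1 i) //= eqxx expr1 big1 ?mulr1 // => k /negbTE ->.
    by rewrite expr0.
  rewrite (bigD1 j) //= eqxx expr1 big1 ?mulr1 // => k /negbTE ->.
  by rewrite expr0.
rewrite -(bigA_distr_bigA g) (bigD1 i) //= big_bool /g eqxx.
case: eqP => [<-|/eqP ne] /=.
  rewrite big1 ?mulr1 => [|k /negbTE ki]; first by rewrite !expr1; field.
  by rewrite big_bool ki /= !expr0 !mulr1; field.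
by rewrite !expr1 !expr0 !mulr1 [X in X * _](_ : _ = 0) ?mul0r //; field.
Qed.

Lemma ber_variance n (I : {set 'I_n}) (d : 'I_n -> R) :
  \sum_y ber y * (\sum_(j in I) d j * ((y j)%:R - 3^-1)) ^+ 2
    = 2 / 9 * \sum_(j in I) d j ^+ 2.
Proof.
transitivity (\sum_(i in I) \sum_(j in I) d i * d j *
   \sum_y ber y * (((y i)%:R - 3^-1) * ((y j)%:R - 3^-1))).
  under eq_bigr do rewrite expr2 mulr_suml mulr_sumr.
  rewrite exchange_big; apply: eq_bigr => i _ /=.
  under eq_bigr do rewrite mulr_sumr mulr_sumr.
  rewrite exchange_big; apply: eq_bigr => j _ /=.
  rewrite mulr_sumr; apply: eq_bigr => y _; ring.
rewrite mulr_sumr; apply: eq_bigr => i iI.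
rewrite (bigD1 i) //= [X in _ + X]big1 => [|j /andP[_ /negbTE ji]].
  by rewrite ber_moment eqxx mulr1n addr0 mul1r expr2 mulrC.
by rewrite ber_moment eq_sym ji mulr0n mul0r mulr0.
Qed.

Lemma sum_ber n : \sum_(y : {ffun 'I_n -> bool}) ber y = 1.
Proof.
rewrite -(bigA_distr_bigA (fun _ b => if b then 3^-1 else 1 - 3^-1)).
by rewrite big1 // => i _; rewrite big_bool /= addrC subrK.
Qed.

(** Pointwise form of Chebyshev's inequality, used for both error probabilities. *)
Lemma markov_sq (D S : R) : 0 < D -> D <= 2 * S -> 1 <= 4 / D ^+ 2 * S ^+ 2.
Proof.
move=> D0 DS; rewrite -mulrA [_^-1 * _]mulrC mulrA ler_pdivlMr ?exprn_gt0 // mul1r.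
nra.
Qed.

(* Conditionally on the values [c] of the common functions, [P j] has mean
   about [mu j c], which is dyadic and hence differs from [1/3] by [d j c].  The
   test compares [\sum_j d j c * (y j - 1/3)], which has mean about
   [\sum_j d j c ^+ 2] under [P] and mean [0] under the Bernoulli law, with half
   the former value, and both error probabilities are bounded by Chebyshev. *)
Lemma uncorrelated_test n m (P : 'I_n -> pt m -> bool) (C : {set fn m})
    (U : 'I_n -> {set fn m}) (I : {set 'I_n}) K b t eps :
  (#|C| <= b)%N -> (forall j, j \in I -> (#|U j| <= K)%N) ->
  (forall j, j \in I -> determined_by (C :|: U j) (P j)) ->
  #|I| = t -> (0 < t)%N -> 0 <= eps ->
  (forall i j, i \in I -> j \in I -> i != j ->
     forall W S S' : {set fn m}, W \subset C -> S \subset U i -> S' \subset U j ->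
     S != set0 -> S' != set0 -> `|bias (xsum S + xsum S' + xsum W)| <= eps) ->
  exists T : {set {ffun 'I_n -> bool}},
    mean (fun x => ([ffun j => P j x] \notin T)%:R) + \sum_(y in T) ber y
    <= 44 * 2 ^+ (2 * K + b) / t%:R + 324 * 2 ^+ (6 * K + 2 * b) * eps.
Proof.
move=> Cb UK Pd It t0 e0 hb.
(* The value of [P j] as a function of the common and private values, with default 0 where no point
   attains them. *)
pose G j c u : R := [exists x, [&& trace C x == c, trace (U j) x == u & P j x]]%:R.
have G01 j c u : 0 <= G j c u <= 1 by rewrite ler0n lern1 leq_b1.
have G1 j c u : `|G j c u| <= 1 by have /andP[h ?] := G01 j c u; rewrite ger0_norm.
have PG j x : j \in I -> (P j x)%:R = G j (trace C x) (trace (U j) x).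
  move=> jI; rewrite /G; congr (nat_of_bool _)%:R; apply/idP/existsP => [Px|[y]].
    by exists x; rewrite !eqxx.
  case/and3P => /eqP/setP cE /eqP/setP uE; rewrite (Pd _ jI x y) // => f.
  by case/setUP => fV; [have := cE f|have := uE f]; rewrite !inE fV.
pose mu j c := fhat (U j) (G j c) set0.
pose d j c := mu j c - 3^-1.
pose D c := \sum_(j in I) d j c ^+ 2.
(* An outcome does not reveal [c], so it is accepted when some [c] passes; the union bound costs a
   factor [2 ^ b]. *)
pose T := [set y : {ffun 'I_n -> bool} | [exists c in powerset C,
   D c <= 2 * \sum_(j in I) d j c * ((y j)%:R - 3^-1)]].
pose Kr : R := 4 ^+ K.
have Kr0 : 0 < Kr by rewrite exprn_gt0 // ltr0n.
have tr0 : 0 < t%:R :> R by rewrite ltr0n.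
have mu01 j c : 0 <= mu j c <= 1.
  have := @fhat_le1 _ (U j) (G j c) set0 (G1 j c); rewrite -/(mu j c) ler_norml.
  case/andP => _ ->; rewrite /mu fhat0 divr_ge0 ?exprn_ge0 ?ler0n //.
  by rewrite sumr_ge0 // => u _; rewrite ler0n.
have d1 j c : `|d j c| <= 1.
  by rewrite /d ler_norml; have /andP[] := mu01 j c => *; apply/andP; split; lra.
have d3 j c : j \in I -> (9 * Kr)^-1 <= d j c ^+ 2.
  move=> jI; rewrite /d /mu fhat0 -natr_sum; exact/dyadic_third/UK.
have Dt c : t%:R / (9 * Kr) <= D c.
  by rewrite mulr_natl -It -sumr_const ler_sum // => j /d3.
have D0 c : 0 < D c.
  by apply: lt_le_trans (Dt c); rewrite divr_gt0 ?mulr_gt0 ?ltr0n.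
pose E : R := 2 ^+ (2 * K + b) * eps.
have E0 : 0 <= E by rewrite mulr_ge0 ?exprn_ge0 ?ler0n.
pose X j c x : R := G j c (trace (U j) x) - mu j c.
have X1 j c x : `|X j c x| <= 1.
  have /andP[h1 h2] := mu01 j c; have /andP[h3 h4] := G01 j c (trace (U j) x).
  by rewrite /X ler_norml; apply/andP; split; lra.
(* The mean is restricted to the event [trace C x = c] without dividing by its probability, so rare
   values of [c] do no harm. Diagonal terms give [D c]; [centered_corr] bounds the others. *)
have second c : mean (fun x => (trace C x == c)%:R * (\sum_(j in I) d j c * X j c x) ^+ 2)
    <= D c + t%:R ^+ 2 * E.
  rewrite (@eq_mean _ _ (fun x => \sum_(i in I) \sum_(j in I)
     (d i c * d j c) * ((trace C x == c)%:R * (X i c x * X j c x)))); last first.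
    move=> x; rewrite expr2 mulr_suml mulr_sumr; apply: eq_bigr => i _.
    rewrite mulr_sumr mulr_sumr; apply: eq_bigr => j _.
    by move: (d i c) (d j c) (X i c x) (X j c x) (_%:R : R) => *; ring.
  rewrite mean_sum /D expr2 -mulrA [X in _ <= _ + X]mulr_natl -It -sumr_const -big_split.
  apply: ler_sum => i iI /=; rewrite mean_sum (bigD1 i) //=; apply: lerD.
    rewrite meanZ -expr2 -[leRHS]mulr1 ler_wpM2l ?sqr_ge0 //.
    rewrite -[leRHS](mean_const (0 : pt m)); apply: ler_mean => x.
    apply: le_trans (ler_norm _) _; rewrite normrM mulr_ile1 ?normr_ge0 //.
      by case: (_ == _); rewrite ?normr1 ?normr0.
    by rewrite normrM mulr_ile1 ?normr_ge0.
  rewrite mulr_natl -sumr_const [leRHS](bigD1 i) //= -[leLHS]add0r lerD //.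
  apply: ler_sum => j /andP[jI ji]; apply: le_trans (ler_norm _) _.
  rewrite meanZ normrM -[leRHS]mul1r ler_pM ?normr_ge0 //.
    by rewrite normrM mulr_ile1 ?normr_ge0.
  have h0 u : `|(u == c)%:R| <= 1 :> R by case: (_ == _); rewrite ?normr1 ?normr0.
  apply: le_trans (centered_corr h0 (G1 i c) (G1 j c) e0 _) _.
    by move=> W S S'; apply: hb; rewrite // eq_sym.
  rewrite ler_wpM2r // ler_weXn2l ?ler1n //.
  by have := UK _ iI; have := UK _ jI; lia.
(* [44 / 9] is 4 from the polynomial law plus [4 * (2 / 9)] from the Bernoulli variance;
   [D c >= t / (9 Kr)] then yields 44 and [4 * 81 = 324]. *)
have errD c : (44 / 9) / D c + 4 * t%:R ^+ 2 * E / D c ^+ 2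
    <= 44 * Kr / t%:R + 324 * Kr ^+ 2 * E.
  have iD : (D c)^-1 <= 9 * Kr / t%:R.
    by rewrite -[leRHS]invf_div lef_pV2 ?posrE ?divr_gt0 ?mulr_gt0 ?ltr0n.
  have iD0 : 0 < (D c)^-1 by rewrite invr_gt0.
  apply: lerD.
    apply: (@le_trans _ _ (44 / 9 * (9 * Kr / t%:R))).
      by rewrite ler_wpM2l // divr_ge0 ?ler0n.
    by rewrite le_eqVlt; apply/orP; left; apply/eqP; field; rewrite gt_eqF.
  rewrite -exprVn; apply: (@le_trans _ _ (4 * t%:R ^+ 2 * E * (9 * Kr / t%:R) ^+ 2)).
    apply: ler_wpM2l; first by rewrite mulr_ge0 // mulr_ge0 ?sqr_ge0 ?ler0n.
    by rewrite lerXn2r ?nnegrE ?(ltW iD0) // (le_trans (ltW iD0)).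
  by rewrite le_eqVlt; apply/orP; left; apply/eqP; field; rewrite gt_eqF.
have q0 c : 0 <= 4 / D c ^+ 2 by rewrite divr_ge0 ?sqr_ge0 ?ler0n.
exists T.
have PT : mean (fun x => ([ffun j => P j x] \notin T)%:R)
   <= \sum_(c in powerset C) 4 / D c ^+ 2 * (D c + t%:R ^+ 2 * E).
  apply: (@le_trans _ _ (mean (fun x => \sum_(c in powerset C) 4 / D c ^+ 2 *
     ((trace C x == c)%:R * (\sum_(j in I) d j c * X j c x) ^+ 2)))); last first.
    rewrite mean_sum; apply: ler_sum => c _; rewrite meanZ ler_wpM2l //.
  apply: ler_mean => x; pose c := trace C x.
  have cC : c \in powerset C.
    by rewrite powersetE; apply/subsetP => f; rewrite inE => /andP[].
  have term0 c' : 0 <= 4 / D c' ^+ 2 *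
     ((trace C x == c')%:R * (\sum_(j in I) d j c' * X j c' x) ^+ 2).
    by rewrite mulr_ge0 // mulr_ge0 ?sqr_ge0 ?ler0n.
  case: (boolP (_ \notin T)) => [nT|_]; last by rewrite sumr_ge0.
  rewrite (bigD1 c) //= -[leLHS]addr0 lerD ?sumr_ge0 // eqxx mul1r -[X in _ <= _ * X]sqrrN.
  apply: markov_sq => //.
  move: nT; rewrite inE negb_exists => /forallP/(_ c); rewrite cC /= -ltNge => lt.
  have -> : - (\sum_(j in I) d j c * X j c x)
     = D c - \sum_(j in I) d j c * (([ffun j => P j x] j)%:R - 3^-1).
    rewrite -sumrN /D -sumrB; apply: eq_bigr => j jI.
    rewrite ffunE PG // -/c /X /d; move: (G _ _ _) (mu j c) => *; ring.
  by move: lt; lra.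
have QT : \sum_(y in T) ber y <= \sum_(c in powerset C) (8 / 9) / D c.
  apply: (@le_trans _ _ (\sum_(c in powerset C) \sum_(y : {ffun 'I_n -> bool}) 4 / D c ^+ 2 *
     (ber y * (\sum_(j in I) d j c * ((y j)%:R - 3^-1)) ^+ 2))).
    rewrite exchange_big [leRHS](bigID (mem T)) /= -[leLHS]addr0.
    have term0 c y : 0 <= 4 / D c ^+ 2 *
       (ber y * (\sum_(j in I) d j c * ((y j)%:R - 3^-1)) ^+ 2).
      by rewrite mulr_ge0 // mulr_ge0 ?sqr_ge0 ?ber_ge0.
    apply: lerD; last by rewrite sumr_ge0 // => y _; rewrite sumr_ge0.
    apply: ler_sum => y; rewrite inE => /existsP[c /andP[cC h]].
    rewrite (bigD1 c) //= -[leLHS]addr0 lerD ?sumr_ge0 // mulrCA.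
    by rewrite -[leLHS]mulr1 ler_wpM2l ?ber_ge0 // markov_sq.
  apply: ler_sum => c _; rewrite -mulr_sumr ber_variance -/(D c).
  by rewrite le_eqVlt; apply/orP; left; apply/eqP; field; rewrite gt_eqF.
apply: le_trans (lerD PT QT) _; rewrite -big_split /=.
apply: (@le_trans _ _ (\sum_(c in powerset C) (44 * Kr / t%:R + 324 * Kr ^+ 2 * E))).
  apply: ler_sum => c _; apply: le_trans (errD c); rewrite le_eqVlt.
  by apply/orP; left; apply/eqP; move: (D c) (D0 c) => a a0; field; rewrite gt_eqF.
rewrite sumr_const card_powerset -[leLHS]mulr_natl natrX.
apply: (@le_trans _ _ (2 ^+ b * (44 * Kr / t%:R + 324 * Kr ^+ 2 * E))).
  rewrite ler_wpM2r ?ler_weXn2l ?ler1n //.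
  apply: addr_ge0; first by rewrite divr_ge0 ?ler0n // mulr_ge0 ?ler0n ?(ltW Kr0).
  by rewrite mulr_ge0 // mulr_ge0 ?ler0n ?sqr_ge0.
have KE : Kr = 2 ^+ (2 * K) by rewrite exprM; congr (_ ^+ _); ring.
rewrite KE /E (_ : 6 * K + 2 * b = 2 * K + 2 * K + (2 * K + b) + b)%N; last by lia.
rewrite !exprD; move: ((2 : R) ^+ (2 * K)) ((2 : R) ^+ b) => x y.
by rewrite le_eqVlt; apply/orP; left; apply/eqP; field; rewrite gt_eqF.
Qed.

(** * Eliminating correlations *)

(** Greedy choice: if all degrees are below [M], each chosen vertex discards at most [M] vertices,
    itself included. *)
Lemma independent_or_dense (T : finType) (e : rel T) (J : {set T}) M t :
  symmetric e -> (0 < M)%N -> (M * t <= #|J|)%N ->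
  (exists I : {set T}, [/\ I \subset J, #|I| = t &
     forall i j, i \in I -> j \in I -> i != j -> ~~ e i j])
  \/ exists2 i, i \in J & (M <= #|[set j in J | (j != i) && e i j]|)%N.
Proof.
move=> es M0 Jt.
have [/existsP[i /andP[iJ Mi]]|] :=
  boolP [exists i in J, (M <= #|[set j in J | (j != i) && e i j]|)%N].
  by right; exists i.
rewrite negb_exists => /forallP sparse; left.
have {}sparse i : i \in J -> (#|[set j in J | (j != i) && e i j]| < M)%N.
  by move=> iJ; have := sparse i; rewrite iJ /= -ltnNge.
have [k kt] : {k | k = t} by exists t.
rewrite -kt in Jt *; clear t kt.
suff ind : forall J' : {set T}, J' \subset J -> (M * k <= #|J'|)%N ->
    exists I : {set T}, [/\ I \subset J', #|I| = k &
      forall i j, i \in I -> j \in I -> i != j -> ~~ e i j].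
  exact: ind.
elim: k {Jt} => [|k IH] J' J'J.
  exists set0; split; [exact: sub0set|exact: cards0|by move=> i j; rewrite inE].
rewrite mulnS => cJ'.
have /set0Pn[i iJ'] : J' != set0 by rewrite -card_gt0 (leq_trans _ cJ') // ltn_addr.
pose B := [set j in J' | (j != i) && e i j].
have cB : (#|i |: B| <= M)%N.
  rewrite (leq_trans (leq_card_setU _ _)) // cards1 add1n.
  apply: leq_ltn_trans (sparse i (subsetP J'J _ iJ')).
  apply/subset_leq_card/subsetP => j; rewrite !inE => /andP[/(subsetP J'J) -> //].
have [|I [IJ cI Ie]] := IH (J' :\: (i |: B)) (subset_trans (subsetDl _ _) J'J).
  by have := cardsID (i |: B) J'; have := subset_leq_card (subsetIr J' (i |: B)); lia.
have iI : i \notin I by apply/negP => /(subsetP IJ); rewrite !inE eqxx.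
have ne j : j \in I -> ~~ e i j.
  move=> jI; have := subsetP IJ _ jI; rewrite !inE => /andP[nb jJ'].
  by move: nb; rewrite jJ' /=; case: eqP.
exists (i |: I); split.
- by rewrite subUset sub1set iJ' (subset_trans IJ) ?subsetDl.
- by rewrite cardsU1 iI cI.
- move=> j k' /setU1P[->|jI] /setU1P[->|kI]; first by rewrite eqxx.
  + by move=> _; apply: ne.
  + by move=> _; rewrite es ne.
  + exact: Ie.
Qed.

Lemma pigeonhole (T T' : finType) (f : T -> T') (Y : {set T}) (B : {set T'}) x y :
  (forall j, j \in Y -> f j \in B) -> (#|B| <= 2 ^ x)%N -> (2 ^ (x + y) <= #|Y|)%N ->
  exists2 b, b \in B & (2 ^ y <= #|[set j in Y | f j == b]|)%N.
Proof.
move=> fB Bx Yxy.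
have [/existsP[b /andP[bB hb]]|] := boolP [exists b in B, (2 ^ y <= #|[set j in Y | f j == b]|)%N].
  by exists b.
rewrite negb_exists => /forallP small.
have [j jY] : exists j, j \in Y.
  by apply/set0Pn; rewrite -card_gt0 (leq_trans _ Yxy) // expn_gt0.
have : (#|Y| <= #|B| * (2 ^ y).-1)%N.
  rewrite -sum1_card (partition_big f (mem B)) //= -sum_nat_const leq_sum // => b bB.
  have := small b; rewrite bB /= -ltnNge => h.
  rewrite -(leq_add2l 1) !add1n prednK ?expn_gt0 //; apply: leq_trans h.
  by rewrite ltnS sum1dep_card; apply/subset_leq_card/subsetP => k; rewrite !inE.
have : (0 < #|B|)%N by apply/card_gt0P; exists (f j); apply: fB.
have : (0 < 2 ^ y)%N by rewrite expn_gt0.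
move: Yxy; rewrite expnD; move: (2 ^ x)%N (2 ^ y)%N Bx => a c; nia.
Qed.

(** Lets a private function be dropped once a sum containing it is determined by what is kept. *)
Lemma xsum_recover m (S : {set fn m}) f x y : f \in S -> xsum S x = xsum S y ->
  (forall g, g \in S -> g != f -> g x = g y) -> f x = f y.
Proof.
move=> fS; rewrite /xsum !sum_ffunE !(bigD1 f fS) /= => e h.
have E : \sum_(g in S | g != f) g x = \sum_(g in S | g != f) g y.
  by apply: eq_bigr => g /andP[gS gf]; rewrite h.
by move: e; rewrite E => /addIr.
Qed.

(** [T] is a distinguishing event; the left side adds its two error probabilities. *)
Definition separated n m (P : 'I_n -> pt m -> bool) (s : nat) :=
  exists T : {set {ffun 'I_n -> bool}},
    mean (fun x => ([ffun j => P j x] \notin T)%:R) + \sum_(y in T) ber y <= 2 ^- s.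

(** The invariant of the elimination. [w] bounds all sizes at once: making a linear sum common
    preserves it, since [K] drops while [C] gains at most one element, and a trade multiplies it by
    13. *)
Record config n m (P : 'I_n -> pt m -> bool) (s a K w : nat) (C : {set fn m})
    (U : 'I_n -> {set fn m}) (J : {set 'I_n}) : Prop := Config {
  common_quadratic : forall f, f \in C -> quadratic f;
  private_quadratic : forall j f, j \in J -> f \in U j -> quadratic f;
  card_private : forall j, j \in J -> (#|U j| <= K)%N;
  card_nonlinear : forall j, j \in J -> (#|U j :\: lin m| <= a)%N;
  output_determined : forall j, j \in J -> determined_by (C :|: U j) (P j);
  width_bound : (K + #|C| + s + 2 <= w)%N }.

(** The exponent [15 * w] pays for the [t] bits of the independent set, [K + b] bits to fix [q] and
    [2 * h + 1] bits to fix the linear sum: in total [3 s + 15 K + 6 b + 28]. *)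
Lemma config_step n m (P : 'I_n -> pt m -> bool) s a K w C U J N :
  config P s a K w C U J -> (2 ^ (15 * w + N) <= #|J|)%N ->
  [\/ separated P s,
      exists K' C' U' J', [/\ K = K'.+1, config P s a K' w C' U' J' & (2 ^ N <= #|J'|)%N]
    | exists a' K' C' U' J', [/\ a = a'.+1, (K' < 13 * w)%N,
        config P s a' K' (13 * w) C' U' J' & (2 ^ N <= #|J'|)%N]].
Proof.
move=> cfg cJ.
(* [2 ^- h] is the correlation threshold and [2 ^ t] the number of uncorrelated
   outputs that suffices for the test. *)
pose b := #|C|; pose h := (s + 6 * K + 2 * b + 10)%N; pose t := (s + 2 * K + b + 7)%N.
pose eps : R := 2%:R ^- h.
have eps0 : 0 <= eps by rewrite invr_ge0 exprn_ge0 ?ler0n.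
have wb := width_bound cfg.
pose e i j := [exists S in powerset (U i), exists S' in powerset (U j),
  exists W in powerset C, [&& S != set0, S' != set0
    & eps < `|bias (xsum S + xsum S' + xsum W)|]].
have es : symmetric e.
  have imp i j : e i j -> e j i.
    case/existsP => S /andP[SU /existsP[S' /andP[SU' /existsP[W]]]].
    case/and4P => WC S0 S0' lt; apply/existsP; exists S'; rewrite SU' /=.
    apply/existsP; exists S; rewrite SU /=; apply/existsP; exists W.
    by rewrite WC S0 S0' /= [xsum S' + _]addrC.
  by move=> i j; apply/idP/idP; apply: imp.
have tw : (t <= 15 * w)%N by rewrite /t /b; lia.
pose y1 := (15 * w - t + N)%N.
have cJ1 : (2 ^ y1 * 2 ^ t <= #|J|)%N.
  by rewrite -expnD /y1 addnAC subnK.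
case: (independent_or_dense es _ cJ1) => [|[I [IJ cI Ie]]|[i iJ ci]].
- by rewrite expn_gt0.
- apply: Or31; have t0 : (0 < 2 ^ t)%N by rewrite expn_gt0.
  have [j /(subsetP IJ)|j /(subsetP IJ)|i j iI jI ij W S S' WC SU SU' S0 S0'|T hT] :=
    @uncorrelated_test n m P C U I K b (2 ^ t) eps (leqnn _) _ _ cI t0 eps0.
  + exact: (card_private cfg).
  + exact: (output_determined cfg).
  + rewrite leNgt; apply: contra (Ie i j iI jI ij) => lt.
    apply/existsP; exists S; rewrite powersetE SU /=.
    apply/existsP; exists S'; rewrite powersetE SU' /=.
    by apply/existsP; exists W; rewrite powersetE WC S0 S0'.
  exists T; apply: le_trans hT _.
  rewrite /eps natrX /t /h.
  have -> : (s + 2 * K + b + 7 = s + (2 * K + b) + 7)%N by lia.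
  have -> : (s + 6 * K + 2 * b + 10 = s + (6 * K + 2 * b) + 10)%N by lia.
  rewrite (exprD _ _ 7) (exprD _ _ 10) (exprD _ s) (exprD _ s (6 * K + _)).
  have p2 k : 0 < (2 : R) ^+ k by rewrite exprn_gt0 ?ltr0n.
  move: ((2 : R) ^+ s) ((2 : R) ^+ (2 * K + b)) ((2 : R) ^+ (6 * K + 2 * b))
    (p2 s) (p2 (2 * K + b)%N) (p2 (6 * K + 2 * b)%N) => u v z u0 v0 z0.
  (* The summands 7 and 10 in [t] and [h] make this constant factor less than 1. *)
  have -> : 44 * v / (u * v * 2 ^+ 7) + 324 * z / (u * z * 2 ^+ 10)
     = (44 / 2 ^+ 7 + 324 / 2 ^+ 10) * u^-1.
    by field; rewrite !gt_eqF.
  rewrite -[leRHS]mul1r ler_wpM2r ?invr_ge0 ?(ltW u0) //; lra.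
pose Y := [set j in J | (j != i) && e i j].
(* The side of an edge at [i] that can be shared: it takes at most [2 ^ (K + b)] values, whatever
   the neighbour. *)
pose Im := [set xsum S + xsum W | S in powerset (U i), W in powerset C].
have YJ j : j \in Y -> j \in J by rewrite inE => /andP[].
(* [f j] is the private function to remove, taken nonlinear whenever [S' j] has a nonlinear
   member. *)
have [q [S' [f hY]]] : exists (q : 'I_n -> fn m) (S' : 'I_n -> {set fn m}) (f : 'I_n -> fn m),
  forall j, j \in Y -> [/\ q j \in Im, S' j \subset U j, f j \in S' j,
    eps < `|bias (q j + xsum (S' j))| & (f j \in lin m -> S' j \subset lin m)].
  suff /fin_all_exists[g hg] : forall j, exists g : fn m * {set fn m} * fn m,
      j \in Y -> [/\ g.1.1 \in Im, g.1.2 \subset U j, g.2 \in g.1.2,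
      eps < `|bias (g.1.1 + xsum g.1.2)| & (g.2 \in lin m -> g.1.2 \subset lin m)].
    by exists (fun j => (g j).1.1), (fun j => (g j).1.2), (fun j => (g j).2).
  move=> j; case jY : (j \in Y); last by exists (0, set0, 0).
  move: jY; rewrite inE => /and3P[_ _ /existsP[S /andP[SU /existsP[S' /andP[SU' /existsP[W]]]]]].
  case/and4P => WC S0 S0' lt.
  have lt' : eps < `|bias (xsum S + xsum W + xsum S')| by rewrite addrAC.
  have qIm : xsum S + xsum W \in Im by apply: imset2_f.
  rewrite powersetE in SU'.
  have [Sl|/subsetPn[f fS fl]] := boolP (S' \subset lin m).
    by have /set0Pn[f fS] := S0'; exists (xsum S + xsum W, S', f).
  by exists (xsum S + xsum W, S', f) => _; split=> //=; rewrite (negbTE fl).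
have cIm : (#|Im| <= 2 ^ (K + b))%N.
  rewrite /Im curry_imset2X (leq_trans (leq_imset_card _ _)) // cardsX !card_powerset -expnD.
  by rewrite leq_exp2l // leq_add2r (card_private cfg).
pose y2 := (15 * w - t - (K + b) + N)%N.
have [q0 q0I c1] : exists2 q0, q0 \in Im & (2 ^ y2 <= #|[set j in Y | q j == q0]|)%N.
  apply: (@pigeonhole _ _ q Y Im (K + b)%N) => // [j /hY[] //|].
  by apply: leq_trans ci; rewrite leq_exp2l // /y1 /y2 /t /b; lia.
set Y1 := [set j in Y | q j == q0] in c1.
(* [None] marks a nonlinear member of [S' j]; otherwise the sum itself is recorded, with at most
   [2 ^ (2 * h)] possibilities by [card_biased_lin]. *)
pose phi j : option (fn m) := if S' j \subset lin m then Some (xsum (S' j)) else None.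
pose L := [set l in lin m | eps < `|bias (q0 + l)|].
have [v vB c2] : exists2 v, v \in None |: [set Some l | l in L]
    & (2 ^ N <= #|[set j in Y1 | phi j == v]|)%N.
  apply: (@pigeonhole _ _ phi Y1 _ (2 * h + 1)%N) => [j||].
  - rewrite inE => /andP[/hY[_ _ _ lt _] /eqP qj]; rewrite /phi.
    case: ifP => Sl; last by rewrite !inE eqxx.
    by rewrite in_setU (imset_f Some) ?orbT // inE -qj lt lin_sum.
  - rewrite (leq_trans (leq_card_setU _ _)) // cards1 addn1 expnS mul2n -addnn add1n.
    apply: (@leq_trans (2 ^ (2 * h)).+1); last first.
      by rewrite -addn1 leq_add2l expn_gt0.
    rewrite ltnS (leq_trans (leq_imset_card _ _)) //; exact: card_biased_lin.
  - by apply: leq_trans c1; rewrite leq_exp2l // /y2 /h /t /b; lia.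
set Y2 := [set j in Y1 | phi j == v] in c2.
have [j0 j0Y] : exists j, j \in Y2.
  by apply/set0Pn; rewrite -card_gt0 (leq_trans _ c2) // expn_gt0.
have hY2 j : j \in Y2 -> [/\ j \in J, q j = q0, phi j = v, S' j \subset U j & f j \in S' j].
  rewrite inE => /andP[]; rewrite inE => /andP[jY /eqP -> /eqP ->].
  by have [_ ? ? _ _] := hY j jY; split=> //; apply: YJ.
have hb j : j \in Y2 -> eps < `|bias (q0 + xsum (S' j))|.
  by move=> jY2; have [_ <- _ _ _] := hY2 j jY2; move: jY2;
     rewrite inE => /andP[]; rewrite inE => /andP[/hY[]].
have hl j : j \in Y2 -> f j \in lin m -> S' j \subset lin m.
  by rewrite inE => /andP[]; rewrite inE => /andP[/hY[]].
have fU j : j \in Y2 -> f j \in U j.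
  by case/hY2 => _ _ _ SU fS; apply: (subsetP SU).
have cD j : j \in Y2 -> (#|U j :\ f j| < K)%N.
  move=> jY2; have [jJ _ _ _ _] := hY2 _ jY2.
  by apply: leq_trans (card_private cfg jJ); rewrite [leqRHS](cardsD1 (f j)) fU.
have K0 : (0 < K)%N by apply: leq_ltn_trans (cD _ j0Y).
have q0q : quadratic q0.
  case/imset2P: q0I => S W; rewrite !powersetE => /subsetP SU /subsetP WC ->.
  apply: quadraticD; apply: quadratic_sum => g gin.
    by apply: (private_quadratic cfg iJ); apply: SU.
  by apply: (common_quadratic cfg); apply: WC.
have Sq j : j \in Y2 -> quadratic (xsum (S' j)).
  case/hY2 => jJ _ _ /subsetP SU _; apply: quadratic_sum => g /SU.
  exact: (private_quadratic cfg jJ).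
clearbody Y2; case: v vB hY2 => [l|] vB hY2.
(* All sums [xsum (S' j)] equal the linear form [l], which becomes common and replaces [f j]. *)
- apply: Or32; exists K.-1, (l |: C), (fun j => U j :\ f j), Y2.
  have ll : l \in lin m.
    case/setU1P: vB => // /imsetP[l' l'L [->]].
    by move: l'L; rewrite inE => /andP[].
  split=> //; first by rewrite prednK.
  split.
  + by move=> g /setU1P[->|/(common_quadratic cfg) //]; apply: lin_quadratic.
  + move=> j g /hY2[jJ _ _ _ _] /setD1P[_]; exact: (private_quadratic cfg jJ).
  + by move=> j /cD; rewrite -{1}(prednK K0) ltnS.
  + move=> j /hY2[jJ _ _ _ _]; apply: leq_trans (card_nonlinear cfg jJ).
    by rewrite subset_leq_card // setSD // subsetDl.
  + move=> j jY2 x y agree; have [jJ _ phij SU fS] := hY2 _ jY2.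
    apply: (output_determined cfg jJ) => g gCU.
    have ag g' : g' \in U j -> g' != f j -> g' x = g' y.
      by move=> g'U ne; apply: agree; rewrite in_setU in_setD1 ne g'U orbT.
    case/setUP: gCU => [gC|gU]; first by apply: agree; rewrite in_setU setU1r.
    have [->|] := eqVneq g (f j); last exact: ag.
    apply: (xsum_recover fS) => [|g' /(subsetP SU)]; last exact: ag.
    move: phij; rewrite /phi; case: ifP => // _ [->].
    by apply: agree; rewrite in_setU setU11.
  + by have := cardsU1 l C; case: (_ \notin _) => ->; lia.
- apply: Or33.
  have nl j : j \in Y2 -> f j \notin lin m.
    by move=> jY2; apply/negP => /(hl _ jY2) Sl; have [_ _] := hY2 _ jY2; rewrite /phi Sl.
  have /fin_all_exists[A hA] : forall j, exists A : {set fn m}, j \in Y2 ->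
      [/\ A \subset lin m, determined_by A (q0 + xsum (S' j)) & (#|A| <= 2 * h)%N].
    move=> j; case jY2 : (j \in Y2); last by exists set0.
    have [|A hA] := @biased_quadratic_forms m (q0 + xsum (S' j)) h _ (hb _ jY2).
      by apply: quadraticD => //; apply: Sq.
    by exists A.
  have nlc j : j \in Y2 -> (#|U j :\ f j :\: lin m| < a)%N.
    move=> jY2; have [jJ _ _ _ _] := hY2 _ jY2.
    apply: leq_trans (card_nonlinear cfg jJ).
    rewrite [leqRHS](cardsD1 (f j)) inE nl // fU //= add1n ltnS.
    by rewrite subset_leq_card // setDDl setUC -setDDl.
  have a0 : (0 < a)%N by apply: leq_ltn_trans (nlc _ j0Y).
  (* The forms [A j] and the common [q0] determine [xsum (S' j)], hence [f j]. Since [h <= 6 * w],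
     the new sizes fit in [w + 12 * w]. *)
  exists a.-1, (K.-1 + 2 * h)%N, (q0 |: C), (fun j => (U j :\ f j) :|: A j), Y2.
  have hw : (h <= 6 * w)%N by rewrite /h /b; lia.
  split=> //; first by rewrite prednK.
    by have := width_bound cfg; lia.
  split.
  + by move=> g /setU1P[->|/(common_quadratic cfg) //].
  + move=> j g jY2; have [jJ _ _ _ _] := hY2 _ jY2; have [Al _ _] := hA _ jY2.
    case/setUP => [/setD1P[_]|/(subsetP Al)]; last exact: lin_quadratic.
    exact: (private_quadratic cfg jJ).
  + move=> j jY2; rewrite (leq_trans (leq_card_setU _ _)) // leq_add //.
      by rewrite -ltnS prednK // cD.
    by have [] := hA _ jY2.
  + move=> j jY2; have [Al _ _] := hA _ jY2.
    rewrite setDUl (_ : A j :\: lin m = set0) ?setU0; last by apply/eqP; rewrite setD_eq0.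
    by rewrite -ltnS prednK // nlc.
  + move=> j jY2 x y agree; have [jJ _ _ SU fS] := hY2 _ jY2; have [_ Ad _] := hA _ jY2.
    apply: (output_determined cfg jJ) => g gCU.
    have ag g' : g' \in U j -> g' != f j -> g' x = g' y.
      by move=> g'U ne; apply: agree; rewrite !inE ne g'U orbT.
    case/setUP: gCU => [gC|gU]; first by apply: agree; rewrite in_setU setU1r.
    have [->|] := eqVneq g (f j); last exact: ag.
    apply: (xsum_recover fS) => [|g' /(subsetP SU)]; last exact: ag.
    have : (q0 + xsum (S' j)) x = (q0 + xsum (S' j)) y.
      by apply: Ad => g' g'A; apply: agree; rewrite !inE g'A !orbT.
    rewrite ffunE [RHS]ffunE (agree q0); first exact: addrI.
    by rewrite in_setU setU11.
  + have : (#|q0 |: C| <= #|C|.+1)%N by rewrite cardsU1; case: (_ \notin _).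
    by move: wb hw K0; move: (h) #|C| #|q0 |: C| => h' c c'; lia.
Qed.

(** Induction on [a], then on [K]. A linear step spends [15 * w]. After a trade [K'.+1 <= 13 * w],
    so with [x = 512 ^ a'] the new budget is at most [(15 * 169 + 16 * 169 * x) * w ^ 2], below
    [16 * 512 * x * w ^ 2]. *)
Lemma config_separated n m (P : 'I_n -> pt m -> bool) s a K w C U J :
  config P s a K w C U J -> (2 ^ (15 * w * K.+1 + 16 * 512 ^ a * w ^ 2) <= #|J|)%N ->
  separated P s.
Proof.
elim/ltn_ind: a K w C U J => a IHa K; elim/ltn_ind: K => K IHK w C U J cfg cJ.
have [|//|[K' [C' [U' [J' [KE cfg' cJ']]]]]|[a' [K' [C' [U' [J' [aE Kw cfg' cJ']]]]]]] :=
  @config_step n m P s a K w C U J (15 * w * K + 16 * 512 ^ a * w ^ 2) cfg.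
- by apply: leq_trans cJ; rewrite leq_exp2l // mulnS addnA.
- by apply: (IHK K' _ _ _ _ _ cfg'); rewrite ?KE // -KE.
- apply: (IHa a' _ _ _ _ _ _ cfg'); first by rewrite aE.
  apply: leq_trans cJ'; rewrite leq_exp2l // aE expnS.
  have w0 : (0 < w)%N by apply: leq_trans (width_bound cfg); rewrite addn2.
  have : (0 < 512 ^ a')%N by rewrite expn_gt0.
  rewrite !expnS !expn0 !muln1; move: (512 ^ a')%N => x x0.
  have h1 : (15 * (13 * w) * K'.+1 <= 2535 * (w * w))%N by nia.
  have h2 : (w * w <= x * (w * w))%N by nia.
  apply: (@leq_trans (16 * (512 * x) * (w * w))); last exact: leq_addl.
  nia.
Qed.

(** * Quadratic polynomials and the initial configuration *)

Lemma quadratic_monomial m (S : {set 'I_m}) : (#|S| <= 2)%N ->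
  quadratic [ffun x : pt m => \big[andb/true]_(i in S) x i].
Proof.
case/boolP: (#|S| == 0)%N => [/eqP/cards0_eq ->|S0] S2.
  by move=> x u v w; rewrite !ffunE !big_set0.
case/boolP: (#|S| == 1)%N => [/cards1P[i ->]|S1] in S2 *.
  move=> x u v w; rewrite !ffunE !big_set1 !ffunE.
  by case: (x i) (u i) (v i) (w i) => [] [] [] [].
have /cards2P[i [j [ij ->]]] : #|S| == 2%N.
  by case: (#|S|) S0 S1 S2 => [|[|[|]]].
have E (y : pt m) : \big[andb/true]_(k in [set i; j]) y k = y i && y j.
  by rewrite big_setU1 ?inE //= big_set1.
move=> x u v w; rewrite !ffunE !E !ffunE.
case: (x i) (u i) (v i) (w i) => [] [] [] [];
by case: (x j) (u j) (v j) (w j) => [] [] [] [].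
Qed.

Lemma poly_deg2_quadratic m (f : pt m -> bool) : poly_deg_le 2 f -> quadratic [ffun x => f x].
Proof.
case=> coef fE; rewrite (_ : [ffun x => f x] = \sum_(S : {set 'I_m} | (#|S| <= 2)%N && coef S)
   [ffun x : pt m => \big[andb/true]_(i in S) x i]).
  elim/big_ind: _ => [x u v w|f1 f2|S /andP[S2 _]]; last exact: quadratic_monomial.
    by rewrite !ffunE.
  exact: quadraticD.
apply/ffunP => x; rewrite ffunE fE sum_ffunE.
by apply: eq_bigr => S _; rewrite ffunE.
Qed.

(** The elimination starts with no common functions, the at most [r] quadratics of each output as
    private ones, and [w = r + s + 2]. *)
Lemma rank2_separated n m (P : 'I_n -> pt m -> bool) r s :
  (forall i, rank2_le (P i) r) ->
  (2 ^ (2 ^ (9 * r + 5) * (r + s + 2) ^ 2) <= n)%N -> separated P s.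
Proof.
move=> Pr nbig.
have /fin_all_exists[U hU] : forall i, exists U : {set fn m},
    [/\ (forall f, f \in U -> quadratic f), (#|U| <= r)%N & determined_by U (P i)].
  move=> i; have [k [_ [kr [Q [Gamma [Q2 PE]]]]]] := Pr i.
  exists [set [ffun x => Q a x] | a : 'I_k]; split.
  - by move=> f /imsetP[a _ ->]; apply: poly_deg2_quadratic.
  - by rewrite (leq_trans (leq_imset_card _ _)) // card_ord.
  - move=> x y h; rewrite !PE; congr Gamma; apply/ffunP => a; rewrite !ffunE.
    have : [ffun x => Q a x] \in [set [ffun x => Q a x] | a : 'I_k] by apply: imset_f.
    by move/h; rewrite !ffunE.
apply: (@config_separated n m P s r r (r + s + 2) set0 U [set: 'I_n]).
  split=> [f|j f _|j _|j _|j _|].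
  - by rewrite inE.
  - by have [h _ _] := hU j; apply: h.
  - by have [] := hU j.
  - by have [_ h _] := hU j; apply: leq_trans h; rewrite subset_leq_card // subsetDl.
  - by rewrite set0U; have [] := hU j.
  - by rewrite cards0 addn0.
rewrite cardsT card_ord; apply: leq_trans nbig; rewrite leq_exp2l //.
(* Of the 32, 16 covers the trades, and the other 16 covers the [15 * w * r.+1] of the linear
   steps. *)
have -> : (2 ^ (9 * r + 5) = 32 * 512 ^ r)%N by rewrite expnD expnM mulnC.
have : (0 < 512 ^ r)%N by rewrite expn_gt0.
move: (512 ^ r)%N => x x0; rewrite !expnS !expn0 !muln1.
set w := (r + s + 2)%N; have rw : (r.+1 <= w)%N by rewrite /w; lia.
have h1 : (15 * w * r.+1 <= 15 * (w * w))%N by rewrite -mulnA leq_mul // leq_mul.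
have h2 : (w * w <= x * (w * w))%N by rewrite leq_pmull.
by nia.
Qed.

End Analysis.

(** * Total variation distance *)

Lemma tvdistE n (D1 D2 : {ffun 'I_n -> bool} -> R) :
  tvdist D1 D2 = 2^-1 * \sum_y `|D1 y - D2 y|.
Proof. by congr (_ * _); apply: eq_bigr => y _; rewrite RabsE. Qed.

(** The law of the outputs exceeds the Bernoulli law on [T], and falls short of it on the
    complement, by 1 minus the sum of the errors; the factor 1/2 averages the two. *)
Lemma tvdist_separated n m (P : 'I_n -> pt m -> bool) s : separated R P s ->
  1 - 2 ^- s <= tvdist (polydist P) (@ber13n n) :> R.
Proof.
case=> T hT.
pose Q y : R := mean (fun x => ([ffun j => P j x] == y)%:R).
have QE y : polydist P y = Q y.
  rewrite /polydist /Q /mean RdivE INRE RpowE card_pt natrX; congr (_ / _).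
  rewrite -sum1_card natr_sum big_mkcond; apply: eq_bigr => x _.
  by rewrite inE; case: eqP.
have bE y : ber13n y = ber R y.
  apply: eq_bigr => i _; case: (y i); rewrite !RdivE; first by rewrite mul1r.
  by change (2 / 3 = 1 - 3^-1 :> R); field.
have -> : tvdist (polydist P) (@ber13n n) = 2^-1 * \sum_y `|Q y - ber R y|.
  by rewrite tvdistE; congr (_ * _); apply: eq_bigr => y _; rewrite QE bE.
have Qsum (A : {set {ffun 'I_n -> bool}}) :
    \sum_(y in A) Q y = mean (fun x => ([ffun j => P j x] \in A)%:R).
  rewrite /Q -mean_sum; apply: eq_mean => x.
  rewrite big_mkcond (bigD1 [ffun j => P j x]) //= eqxx big1 ?addr0; last first.
    by move=> y; rewrite eq_sym => /negbTE ->; case: ifP.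
  by case: (_ \in A).
have Q1 : \sum_(y in T) Q y + \sum_(y in ~: T) Q y = 1.
  rewrite !Qsum -meanD -[RHS](mean_const (0 : pt m)); apply: eq_mean => x.
  by rewrite inE; case: (_ \in T); rewrite ?addr0 ?add0r.
have B1 : \sum_(y in T) ber R y + \sum_(y in ~: T) ber R y = 1.
  rewrite -[RHS](sum_ber R n) [RHS](bigID (mem T)) /=; congr (_ + _).
  by apply: eq_bigl => y; rewrite inE.
have hT' : \sum_(y in ~: T) Q y + \sum_(y in T) ber R y <= 2 ^- s.
  rewrite Qsum (@eq_mean _ _ _ (fun x => ([ffun j => P j x] \notin T)%:R)) // => x.
  by rewrite inE.
have -> : \sum_y `|Q y - ber R y|
    = \sum_(y in T) `|Q y - ber R y| + \sum_(y in ~: T) `|Q y - ber R y|.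
  rewrite [LHS](bigID (mem T)) /=; congr (_ + _); by apply: eq_bigl => y; rewrite inE.
have h1 : \sum_(y in T) Q y - \sum_(y in T) ber R y <= \sum_(y in T) `|Q y - ber R y|.
  by rewrite -sumrB; apply: ler_sum => y _; exact: ler_norm.
have h2 : \sum_(y in ~: T) ber R y - \sum_(y in ~: T) Q y <= \sum_(y in ~: T) `|Q y - ber R y|.
  by rewrite -sumrB; apply: ler_sum => y _; rewrite distrC; exact: ler_norm.
move: Q1 B1 hT' h1 h2.
move: (\sum_(y in T) Q y) (\sum_(y in ~: T) Q y) (\sum_(y in T) ber R y)
  (\sum_(y in ~: T) ber R y) (\sum_(y in T) `|Q y - ber R y|)
  (\sum_(y in ~: T) `|Q y - ber R y|) ((2 : R) ^- s) => a b c d e f g *; lra.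
Qed.

Lemma tvdist_ge0 n (D1 D2 : {ffun 'I_n -> bool} -> R) : 0 <= tvdist D1 D2 :> R.
Proof. by rewrite tvdistE mulr_ge0 ?invr_ge0 ?ler0n ?sumr_ge0. Qed.

(** Forces [delta <= 2/3], so that dividing by [delta ^ 2] only weakens the bound. *)
Lemma prob1_third m (f : pt m -> bool) : `|prob1 f - 3^-1| <= 2 / 3 :> R.
Proof.
have -> : prob1 f = #|[set x | f x]|%:R / #|pt m|%:R.
  by rewrite /prob1 RdivE INRE RpowE card_pt natrX.
have c0 : 0 < #|pt m|%:R :> R by rewrite ltr0n card_pt expn_gt0.
have h1 : 0 <= #|[set x | f x]|%:R / #|pt m|%:R :> R by rewrite divr_ge0 ?ler0n.
have h2 : #|[set x | f x]|%:R / #|pt m|%:R <= 1 :> R.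
  by rewrite ler_pdivrMr // mul1r ler_nat max_card.
rewrite ler_norml; move: (_ / _) h1 h2 => a *; apply/andP; split; lra.
Qed.

Open Scope R_scope.

Theorem theorem10p1 :
  exists c : R, 0 < c /\
  forall (r n m : nat) (delta : R) (P : 'I_n -> pt m -> bool),
    is_true (leq 2 r) -> 0 < delta ->
    INR r <= sqrt (log2 (log2 (INR n))) ->
    (forall i : 'I_n,
        poly_deg_le 3 (P i) /\ rank2_le (P i) r /\
        delta <= Rabs (prob1 (P i) - 1/3)) ->
    tvdist (polydist P) (@ber13n n)
      >= 1 - Rpower 2 (- Rpower (log2 (INR n)) (c / (INR r)^2)) / delta^2.
Proof.
(* Small enough that [s <= 11/10] whenever the iterated logarithm of [n] is at most [1000 r^2]. *)
exists (/ 10000); split; first by apply: Rinv_0_lt_compat; apply: IZR_lt.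
move=> r n m delta P r2 d0 rL hP.
have [n0 hs] := parameters r2 rL; set s := Rpower _ _ in hs *.
have d23 : delta <= 2 / 3.
  have [_ [_]] := hP (Ordinal n0); move/Rle_trans; apply.
  have /RleP := prob1_third (P (Ordinal n0)); rewrite -RabsE.
  by rewrite /Rdiv Rmult_1_l.
apply: Rle_ge; case: hs => [s1|[k [sk kn]]].
  by apply: (Rle_trans _ 0); [apply: loss_trivial|apply/RleP/tvdist_ge0].
apply: (Rle_trans _ (1 - / 2 ^ k)); first exact: loss_bound.
have /RleP := tvdist_separated (rank2_separated R (fun i => proj1 (proj2 (hP i))) kn).
by rewrite -RpowE.
Qed.
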